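(* Assume that every multigraph $H$ satisfies $\chi'(H)\le \max\{\Delta(H)+1,\ \lceil \Gamma(H)\rceil\}$. Let $G=(V,E)$ be a multigraph, let $Z\subseteq V$, let $k$ be a positive integer, and let $\epsilon\in\{0,1\}$. If $d(z)\ge k+1$ for all $z\in Z$ and $|E^+(U)|\ge \frac{|U|+1}{2}k+\epsilon$ for every subset $U\subseteq Z$ with $|U|$ odd and $|U|\ge 3$, then $G$ contains $k-1+\epsilon$ pairwise disjoint $Z$-covers.
   Context: Multigraphs are finite, may have parallel edges, and have no loops. For a multigraph $H$: $\Delta(H)$ is its maximum degree; the chromatic index $\chi'(H)$ is the least $k$ such that the edges can be colored with $k$ colors so that each vertex is incident with at most one edge of each color; $\Gamma(H)=\max\{\frac{2|E(U)|}{|U|-1}: U\subseteq V(H),\ |U|\ge 3,\ |U| \text{ odd}\}$, where $E(U)$ is the set of edges with both ends in $U$. For $G=(V,E)$, $d(z)$ is the degree of vertex $z$, and for $U\subseteq V$, $E^+(U)$ is the set of edges with at least one end in $U$. For $Z\subseteq V$, a $Z$-cover is a set $C\subseteq E$ such that every vertex of $Z$ is incident with at least one edge of $C$. *)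

(* Defs.v *)
From HB Require Import structures.
From mathcomp Require Import all_boot all_order all_algebra.
Set Implicit Arguments.
Unset Strict Implicit.
Unset Printing Implicit Defensive.
Import Order.TTheory GRing.Theory Num.Theory.

(* Edges form their own type, so parallel edges are distinct elements with the
   same ends; requiring exactly two ends excludes loops. *)
Record multigraph := Multigraph {
  vertex : finType;
  edge : finType;
  ends : edge -> {set vertex};
  card_ends : forall e : edge, #|ends e| = 2 }.

Arguments ends {m} e.

Section Multigraph.

Variable G : multigraph.

Definition incident (v : vertex G) : {set edge G} := [set e | v \in ends e].

Definition degree (v : vertex G) : nat := #|incident v|.

Definition max_degree : nat := \max_(v : vertex G) degree v.

Definition edges_within (U : {set vertex G}) : {set edge G} :=
  [set e | ends e \subset U].

Definition edges_touching (U : {set vertex G}) : {set edge G} :=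
  [set e | [exists v in ends e, v \in U]].

Definition proper_coloring (k : nat) (c : {ffun edge G -> 'I_k}) : bool :=
  [forall v : vertex G, forall i : 'I_k,
     #|[set e in incident v | c e == i]| <= 1].

Definition edge_colorable (k : nat) : bool :=
  [exists c : {ffun edge G -> 'I_k}, proper_coloring c].

Lemma edge_colorable_card : exists k, edge_colorable k.
Proof.
exists #|edge G|; apply/existsP; exists [ffun e => enum_rank e].
apply/forallP=> v; apply/forallP=> i; apply/card_le1_eqP => e f.
rewrite !inE !ffunE => /andP[_ /eqP <-] /andP[_ /eqP].
by move/enum_rank_inj.
Qed.

Definition chromatic_index : nat := ex_minn edge_colorable_card.

(* The value is 0 when there is no odd set of at least three vertices; all the
   ratios are nonnegative, so 0 does not affect the maximum otherwise. *)
Definition Gamma : rat :=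
  (\big[Num.max/0]_(U : {set vertex G} | odd #|U| && (3 <= #|U|)%N)
     ((2 * #|edges_within U|)%:R / (#|U| - 1)%:R))%R.

Definition is_cover (Z : {set vertex G}) (C : {set edge G}) : Prop :=
  forall z, z \in Z -> exists2 e, e \in C & z \in ends e.

End Multigraph.

Arguments chromatic_index G : clear implicits.

(* Main.v *)
(* Write n = k - 1 + eps.  Detaching an edge from an end z in Z moves that end
   to a new vertex of degree 1.  As long as some z in Z has degree greater than
   n + 1, some edge can be detached from z while every odd U in Z still
   satisfies 2 |E^+(U)| >= n (|U| + 1) + 2: the tight sets containing z are
   closed under intersection, and z has an edge to another vertex of the least
   one.  When all degrees in Z equal n + 1, this inequality bounds Gamma of the
   detached multigraph by n + 2, so its edges have a proper coloring with n + 2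
   colors, and each z in Z misses exactly one color.  The last two color classes
   repair the first n ones: a vertex missing one of the first n colors has two
   edges in the last two classes, and each edge has at most two ends, so these
   vertices have distinct representatives among these edges. *)
Require Import Defs.
From HB Require Import structures.
From mathcomp Require Import all_boot all_order all_algebra.
From mathcomp Require Import zify lra.
Import Order.TTheory GRing.Theory Num.Theory.

Set Implicit Arguments.
Unset Strict Implicit.
Unset Printing Implicit Defensive.

(** * Distinct representatives for sparse set families *)

Lemma card_setE (T : finType) (P : pred T) :
  #|[set x | P x]| = \sum_x P x.
Proof. by rewrite cardsE -sum1_card big_mkcond; apply: eq_bigr => x _; rewrite unfold_in; case: (P x). Qed.

(* At most one set, that of the vertex in [x0], may have a single element.
   After a representative of it has been removed from [A], at most one other
   set has lost an element, and it takes over the role of [x0]. *)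
Lemma sdr_sparse (V E : finType) (F : V -> {set E}) (x0 : option V)
    (N : {set V}) (A : {set E}) :
  (forall z, z \in N -> (Some z != x0) < #|F z :&: A|) ->
  (forall e, e \in A -> #|[set z in N | e \in F z]| <= 2) ->
  exists s : V -> option E,
    (forall z, z \in N -> exists2 e, s z = Some e & e \in F z :&: A) /\
    {in N &, injective s}.
Proof.
have [m] := ubnP #|N|; elim: m => // m IHm in x0 N A *.
rewrite ltnS => leNm F2 deg2.
have [-> | [w wN]] := set_0Vmem N.
  by exists (fun=> None); split=> [z|z ?]; rewrite inE.
have [z [zN Nz Fz]] : exists z, [/\ z \in N, 0 < #|F z :&: A| &
    forall y, y \in N -> y != z -> 1 < #|F y :&: A|].
  have Npos y : y \in N -> 0 < #|F y :&: A| by move/F2; case: #|_|.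
  have [/existsP[x /andP[xN /eqP xx0]] | /existsPn none] :=
      boolP [exists x in N, Some x == x0].
    exists x; split=> [//||y yN yx]; first exact: Npos.
    by have := F2 y yN; rewrite -xx0 (inj_eq Some_inj) yx.
  exists w; split=> [//||y yN _]; first exact: Npos.
  by have := F2 y yN; have := none y; rewrite yN => /= ->.
have /card_gt0P[e /setIP[eF eA]] := Nz.
have cardA y : #|F y :&: A| <= (#|F y :&: (A :\ e)| + (e \in F y))%N.
  rewrite (cardsD1 e (F y :&: A)) setIDA !inE eA andbT addnC leq_add2r.
  by rewrite subset_leq_card.
have cardN y : #|[set x in N | y \in F x]| =
    ((y \in F z) + #|[set x in N :\ z | y \in F x]|)%N.
  rewrite (cardsD1 z) !inE zN; congr (_ + _)%N; apply: eq_card => x.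
  by rewrite !inE andbA.
pose S := [set x in N :\ z | e \in F x].
(* At most two sets contain [e], and [F z] is one of them. *)
have S1 : #|S| <= 1 by have := deg2 e eA; rewrite cardN eF.
have [x1 x1P] : exists x1, forall y, y \in N :\ z -> Some y != x1 -> e \notin F y.
  have [S0 | [x1 x1S]] := set_0Vmem S.
    by exists None => y yN _; apply: contraFN (in_set0 y) => ?; rewrite -S0 inE yN.
  exists (Some x1) => y yN; apply: contra => eFy; apply/eqP; congr Some.
  by apply: (card_le1_eqP S1) => //; rewrite inE yN.
have [|y yN|y|s [sF sI]] := IHm x1 (N :\ z) (A :\ e).
- by move: leNm; rewrite (cardsD1 z) zN.
- have := cardA y; have := x1P y yN.
  move: yN; rewrite !inE => /andP[yz yN]; have := Fz y yN yz.
  case: (_ != _) => /= [Fy /(_ isT)/negPf -> | ]; first by lia.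
  by case: (e \in _) => /=; lia.
- rewrite !inE => /andP[_ yA]; apply: leq_trans (deg2 y yA).
  by rewrite cardN leq_addl.
have sNe y : y \in N -> y != z -> s y != Some e.
  move=> yN yz; have [|e' -> ] := sF y; first by rewrite !inE yz.
  by rewrite !inE => /andP[_ /andP[+ _]]; apply: contraNneq => -[->].
exists (fun y => if y == z then Some e else s y); split=> [y yN|x y xN yN].
  case: eqVneq => [->|yz]; first by exists e; rewrite // inE eF.
  have [|e' ? ] := sF y; first by rewrite !inE yz.
  by rewrite !inE => /and3P[? _ ?]; exists e' => //; rewrite inE; apply/andP.
case: eqVneq => [->|xz]; case: eqVneq => [->|yz] //.
- by move/esym/eqP; rewrite (negPf (sNe y yN yz)).
- by move/eqP; rewrite (negPf (sNe x xN xz)).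
- by apply: sI; rewrite !inE ?xz ?yz.
Qed.

(** * Detaching ends and uncrossing tight sets *)

Section Detachment.

Variables (V E : finType).
Implicit Types (h : E -> {set V}) (U W Z : {set V}).

(* [h e] is the set of the ends to which the edge [e] is still attached. *)
Definition flag_degree h (z : V) : nat := #|[set e | z \in h e]|.

Definition touching h U : nat := #|[set e | h e :&: U != set0]|.

Lemma sum_flag_degree h U :
  \sum_(z in U) flag_degree h z = \sum_e #|h e :&: U|.
Proof.
under eq_bigr do rewrite /flag_degree card_setE.
rewrite exchange_big; apply: eq_bigr => e _.
rewrite -sum1_card [RHS]big_mkcond [LHS]big_mkcond /=.
apply: eq_bigr => z _.
by rewrite inE andbC; case: (z \in U) => //=; case: (z \in h e).
Qed.

Lemma touchingE h U : touching h U = \sum_e (h e :&: U != set0).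
Proof. exact: card_setE. Qed.

Lemma touching_setIU h U W :
  touching h (U :&: W) + touching h (U :|: W) <= touching h U + touching h W.
Proof.
rewrite !touchingE -!big_split /=; apply: leq_sum => e _.
rewrite setIUr setU_eq0.
have [_ | /set0Pn[x]] := eqVneq (h e :&: (U :&: W)) set0.
  by case: (_ == _); case: (_ == _).
rewrite !inE => /and3P[xe xU xW].
have -> : h e :&: U != set0 by apply/set0Pn; exists x; rewrite inE xe.
have -> : h e :&: W != set0 by apply/set0Pn; exists x; rewrite inE xe.
by case: (_ && _).
Qed.

(** Edge by edge: an edge avoiding the intersection meets [U] or [W] wherever it meets a difference.
    An edge meeting the intersection counts 2 on the right, and at most [#|h e|] on the left because
    the three sets are disjoint. *)
Lemma touching_setD h U W : (forall e, #|h e| <= 2) ->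
  touching h (U :\: W) + touching h (W :\: U)
    + \sum_(z in U :&: W) flag_degree h z <= touching h U + touching h W.
Proof.
move=> h2; rewrite sum_flag_degree !touchingE -!big_split /=.
apply: leq_sum => e _.
have card0 (A : {set V}) : (A != set0) <= #|A| by rewrite -card_gt0; case: #|A|.
have [I0 | /set0Pn[x]] := eqVneq (h e :&: (U :&: W)) set0.
  rewrite I0 cards0 addn0; apply: leq_add.
    rewrite -[U in leqRHS](setID _ W) setIUr I0 set0U //.
  by rewrite -[W in leqRHS](setID _ U) setIUr (setIC W) I0 set0U.
rewrite !inE => /and3P[xe xU xW].
have -> : h e :&: U != set0 by apply/set0Pn; exists x; rewrite inE xe.
have -> : h e :&: W != set0 by apply/set0Pn; exists x; rewrite inE xe.
apply: leq_trans (h2 e).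
rewrite -(cardsID U (h e)) -(cardsID W (h e :&: U)).
have -> : h e :&: (W :\: U) = (h e :\: U) :&: W.
  by apply/setP=> y; rewrite !inE andbCA andbA.
have := card0 (h e :&: (U :\: W)); have := card0 ((h e :\: U) :&: W).
have := subset_leq_card (subsetIl (h e :\: U) W).
by rewrite !setIDA setIA; lia.
Qed.

Variables (n : nat) (Z : {set V}).

(** Singletons are among the odd sets, so uncrossing needs no separate case for differences of one
    vertex. *)
Definition well_spread h : Prop :=
  (forall z, z \in Z -> n < flag_degree h z) /\
  (forall U, U \subset Z -> odd #|U| ->
     n * (#|U| + 1) + 2 <= 2 * touching h U).

Definition remove_flag h (z : V) (e : E) (f : E) : {set V} :=
  if f == e then h f :\ z else h f.

Lemma remove_flag_sub h z e f : remove_flag h z e f \subset h f.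
Proof. by rewrite /remove_flag; case: eqP => // _; apply: subsetDl. Qed.

Lemma flag_degree_remove h z e y : z \in h e ->
  flag_degree h y = flag_degree (remove_flag h z e) y + (y == z).
Proof.
move=> ze; rewrite /flag_degree /remove_flag; case: eqVneq => [->|yz].
  rewrite (cardsD1 e) inE ze addnC; congr (_ + _)%N; apply: eq_card => f.
  by rewrite !inE; case: eqVneq => //=; rewrite !inE eqxx.
rewrite addn0; apply: eq_card => f; rewrite !inE.
by case: eqVneq => //; rewrite !inE yz.
Qed.

(** Only [e] can stop touching [U], and only if [z] was its sole attached end there. *)
Lemma touching_remove h z e U : z \in h e ->
  touching h U <= touching (remove_flag h z e) U
    + ((z \in U) && ((h e :\ z) :&: U == set0)).
Proof.
move=> ze; rewrite !touchingE (bigD1 e) //= [in leqRHS](bigD1 e) //=.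
rewrite [X in _ + X <= _](eq_bigr
  (fun f => (remove_flag h z e f :&: U != set0) : nat)); last first.
  by move=> f /negPf fe; rewrite /remove_flag fe.
rewrite addnAC leq_add2r /remove_flag eqxx.
case: (eqVneq ((_ :\ z) :&: U)) => [e0|_]; last by case: (_ != _).
rewrite andbT; have [//|zU] := boolP (z \in U); first by case: (_ != _).
suff -> : h e :&: U = set0 by rewrite eqxx.
rewrite -e0; apply/setP=> y; rewrite !inE; case: eqVneq => // ->.
by rewrite (negPf zU) andbF.
Qed.

Lemma leq_sum_flag_degree h U : (forall e, #|h e| <= 2) ->
  \sum_(z in U) flag_degree h z <= 2 * touching h U.
Proof.
move=> h2; rewrite sum_flag_degree touchingE big_distrr; apply: leq_sum => e _.
case: (eqVneq (h e :&: U)) => [->|_] /=; first by rewrite cards0.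
by rewrite (leq_trans _ (h2 e)) // subset_leq_card ?subsetIl.
Qed.

Lemma leq_card_sum_flag_degree h U : well_spread h -> U \subset Z ->
  #|U| * n.+1 <= \sum_(z in U) flag_degree h z.
Proof.
move=> [hdeg _] UZ; rewrite -sum_nat_const; apply: leq_sum => z zU.
exact/hdeg/(subsetP UZ).
Qed.

Definition tight h (z : V) U : bool :=
  [&& z \in U, U \subset Z, odd #|U| &
      2 * touching h U == n * (#|U| + 1) + 2].

(** If the intersection is odd, so is the union; both obey the lower bound, and submodularity turns
    both bounds into equalities. *)
Lemma tight_setI h z U W : (forall e, #|h e| <= 2) -> well_spread h ->
  n.+1 < flag_degree h z -> tight h z U -> tight h z W -> tight h z (U :&: W).
Proof.
move=> h2 wh dz /and4P[zU UZ oU /eqP tU] /and4P[zW WZ oW /eqP tW].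
have cUW := cardsUI U W; have IZ := subset_trans (subsetIl U W) UZ.
have UWZ : U :|: W \subset Z by rewrite subUset UZ.
have [oI | eI] := boolP (odd #|U :&: W|).
  have oUW : odd #|U :|: W|.
    by have := congr1 odd cUW; rewrite !oddD oU oW oI; case: (odd _).
  rewrite /tight inE zU zW IZ oI /= eqn_leq wh.2 // andbT.
  have := wh.2 _ UWZ oUW; have := touching_setIU h U W.
  by have := congr1 (muln n) cUW; lia.
(* An even intersection is impossible: uncrossing into the odd differences
   leaves a deficit, because the degree of z exceeds n + 1. *)
have cU := cardsID W U; have cW := cardsID U W.
have := touching_setD U W h2; rewrite (setIC W U) in cW.
have zI : z \in U :&: W by rewrite inE zU.
have := leq_card_sum_flag_degree wh (subset_trans (subsetDl (U :&: W) [set z]) IZ).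
have cI := cardsD1 z (U :&: W); rewrite zI in cI.
rewrite -cU cI in tU; rewrite -cW cI in tW; rewrite (big_setD1 z zI) /=.
have oD : odd #|U :\: W| by move: oU; rewrite -cU oddD (negPf eI).
have oD' : odd #|W :\: U| by move: oW; rewrite -cW oddD (negPf eI).
have := wh.2 _ (subset_trans (subsetDl U W) UZ) oD.
have := wh.2 _ (subset_trans (subsetDl W U) WZ) oD'.
lia.
Qed.

(** Otherwise the edges at [z] are disjoint from those touching [U :\ z]. The latter number at least
    half the degree sum of [U :\ z], so [2 * touching h U] would be at least
    [2 * (n + 2) + (#|U| - 1) * (n + 1)], too much for a tight set. *)
Lemma tight_neighbor h z U : (forall e, #|h e| <= 2) -> well_spread h ->
  n.+1 < flag_degree h z -> tight h z U ->
  exists2 e, z \in h e & (h e :\ z) :&: U != set0.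
Proof.
move=> h2 wh dz /and4P[zU UZ oU /eqP tU].
case: (pickP [pred e | (z \in h e) && ((h e :\ z) :&: U != set0)]).
  by move=> e /andP[? ?]; exists e.
move=> none; exfalso.
have : flag_degree h z + touching h (U :\ z) <= touching h U.
  rewrite /flag_degree card_setE !touchingE -big_split; apply: leq_sum => e _ /=.
  rewrite setIDA -setIDAC; have := none e; rewrite /=.
  case: (boolP (z \in h e)) => [ze /= /negbFE -> | _ _].
    suff -> : h e :&: U != set0 by [].
    by apply/set0Pn; exists z; rewrite inE ze.
  rewrite setIDAC; have [-> | _] := eqVneq (h e :&: U); first by rewrite set0D eqxx.
  exact: leq_b1.
have := leq_sum_flag_degree (U :\ z) h2.
have := leq_card_sum_flag_degree wh (subset_trans (subsetDl U [set z]) UZ).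
by move: tU; rewrite (cardsD1 z U) zU; lia.
Qed.

Lemma well_spread_remove h z : (forall e, #|h e| <= 2) -> well_spread h ->
  n.+1 < flag_degree h z ->
  exists2 e, z \in h e & well_spread (remove_flag h z e).
Proof.
move=> h2 wh dz.
(* An edge with another attached end in each tight set through [z] still touches all of them after
   the removal. *)
suff [e ze he] : exists2 e, z \in h e &
    forall U, tight h z U -> (h e :\ z) :&: U != set0.
  exists e => //; split=> [y yZ|U UZ oU].
    have := flag_degree_remove y ze; have := wh.1 y yZ.
    by case: eqVneq => [->|_]; lia.
  have := touching_remove U ze; have := wh.2 U UZ oU; have := he U.
  rewrite /tight UZ oU; case: (z \in U) => /=; last by lia.
  case: eqP => [_ /(_ isT) /negPf -> /=|tU _]; first by lia.
  (* As [#|U|] is odd, [n * (#|U| + 1) + 2] is even: a set that is not tight has slack at least 2,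
     which pays for one lost edge. *)
  have := oU; have : (_ : bool) <= 1 := leq_b1 ((h e :\ z) :&: U == set0).
  lia.
case: (pickP (tight h z)) => [U1 tU1|none]; last first.
  have /card_gt0P[e] : 0 < flag_degree h z by lia.
  by rewrite inE => ze; exists e => // U; rewrite none.
(* A smallest tight set lies in every other one, since their intersection is tight too; a neighbor
   of [z] inside it serves all of them. *)
case: (arg_minnP (fun U : {set V} => #|U|) tU1) => U tU minU.
have [e ze eU] := tight_neighbor h2 wh dz tU; exists e => // W tW.
have /minU leUI := tight_setI h2 wh dz tU tW.
have /eqP/setIidPl UW : U :&: W == U by rewrite eqEcard subsetIl.
by apply: contraNneq eU => eW; rewrite -subset0 -eW setIS.
Qed.

Lemma exists_exact_detachment h : (forall e, #|h e| <= 2) -> well_spread h ->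
  exists g : E -> {set V}, [/\ forall e, g e \subset h e, well_spread g &
    forall z, z \in Z -> flag_degree g z = n.+1].
Proof.
have [m] := ubnP (\sum_e #|h e|); elim: m => // m IHm in h *.
rewrite ltnS => lehm h2 wh.
have [/existsP[z /andP[zZ dz]] | /existsPn none] :=
    boolP [exists z in Z, n.+1 < flag_degree h z]; last first.
  exists h; split=> // z zZ; apply/eqP; rewrite eqn_leq wh.1 // andbT leqNgt.
  by have := none z; rewrite zZ.
have [e ze wr] := well_spread_remove h2 wh dz.
have [|f|g [gh wg dg]] := IHm (remove_flag h z e) _ _ wr.
- apply: leq_trans lehm; rewrite (bigD1 e) //= [X in _ < X](bigD1 e) //=.
  rewrite /remove_flag eqxx (cardsD1 z (h e)) ze add1n addSn ltnS leq_add2l.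
  by apply: leq_sum => f /negPf ->.
- exact: leq_trans (subset_leq_card (remove_flag_sub _ _ _ _)) (h2 f).
by exists g; split=> // f; apply: subset_trans (gh f) (remove_flag_sub _ _ _ _).
Qed.

End Detachment.

(** * Turning a coloring into disjoint covers *)

Lemma covers_of_near_coloring (V E : finType) (n : nat) (h : E -> {set V})
    (Z : {set V}) (c : E -> 'I_n.+2) :
  (forall e, #|h e| <= 2) ->
  (forall z, z \in Z -> flag_degree h z = n.+1) ->
  (forall z e f, z \in h e -> z \in h f -> c e = c f -> e = f) ->
  exists C : 'I_n -> {set E},
    (forall i z, z \in Z -> exists2 e, e \in C i & z \in h e) /\
    (forall i j, i != j -> [disjoint C i & C j]).
Proof.
move=> h2 dZ proper_c.
pose missing z := ~: (c @: [set e | z \in h e]).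
(* The [n + 1] edges at [z] have distinct colors among [n + 2]. *)
have missing1 z : z \in Z -> #|missing z| = 1.
  move=> zZ; apply/eqP; rewrite -(eqn_add2l #|c @: [set e | z \in h e]|).
  rewrite cardsC card_ord card_in_imset; last first.
    by move=> e f; rewrite !inE => ze zf; apply: proper_c ze zf.
  by have := dZ z zZ; rewrite /flag_degree => ->; rewrite addn1.
have missing_eq z x y : z \in Z -> x \in missing z -> y \in missing z -> x = y.
  move=> zZ xm ym; have : #|missing z| <= 1 by rewrite missing1.
  by move/card_le1_eqP; apply.
pose A := [set e | n <= c e].
pose F z := [set e | z \in h e].
pose N := [set z in Z | [exists x in missing z, x < n]].
(* The only color missing at a vertex of [N] is below [n], so the colors [n] and [n + 1] both occur
   there. *)
have seen z (x : 'I_n.+2) : z \in N -> n <= x -> exists2 e, z \in h e & c e = x.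
  rewrite inE => /andP[zZ /exists_inP[y ym yn]] nx.
  have : x \notin missing z.
    by apply: contraTN nx => xm; rewrite (missing_eq z x y) // -ltnNge.
  by rewrite inE negbK => /imsetP[e]; rewrite inE => ze ->; exists e.
have F2 z : z \in N -> 1 < #|F z :&: A|.
  move=> zN; have [|e ze ce] := seen z (inord n) zN; first by rewrite inordK.
  have [//|f zf cf] := seen z ord_max zN.
  apply/card_gt1P; exists e, f; rewrite !inE ze zf ce cf /= inordK // leqnn.
  split=> //; apply: contra_eqN cf => /eqP <-; rewrite ce.
  by apply/eqP => /(congr1 val); rewrite /= inordK // => /eqP; rewrite ltn_eqF.
have [z zN|e _|s [sF sI]] := @sdr_sparse V E F None N A.
- exact: F2.
- apply: leq_trans (h2 e); apply: subset_leq_card; apply/subsetP=> z.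
  by rewrite !inE => /andP[].
pose lacks z (i : 'I_n) := widen_ord (leqW (leqnSn n)) i \in missing z.
(* Color class [i], completed by the representatives of the vertices that lack color [i]. *)
pose C (i : 'I_n) := [set e | (c e == i :> nat) ||
                     [exists z in N, (s z == Some e) && lacks z i]].
exists C; split=> [i z zZ | i j].
  have [zi | zi] := boolP (lacks z i).
    have zN : z \in N.
      rewrite inE zZ; apply/exists_inP; exists (widen_ord (leqW (leqnSn n)) i) => //.
      exact: (ltn_ord i).
    have [e se] := sF z zN; rewrite !inE => /andP[ze _]; exists e => //.
    by rewrite inE; apply/orP; right; apply/exists_inP; exists z; rewrite // se eqxx.
  move: zi; rewrite /lacks inE negbK => /imsetP[e]; rewrite inE => ze ce.
  by exists e => //; rewrite inE -ce eqxx.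
apply: contraR => /pred0Pn[e /andP[/=]]; rewrite !inE.
(* Representatives have one of the last two colors, so they avoid the first [n] classes. A
   representative shared by two covers would belong to one vertex missing two colors. *)
have late z : z \in N -> s z == Some e -> n <= c e.
  by move=> zN /eqP se; have [f] := sF z zN; rewrite se !inE => -[->] /andP[].
case/orP=> [/eqP ci | /exists_inP[y yN /andP[sy yi]]];
  case/orP=> [/eqP cj | /exists_inP[z zN /andP[sz zj]]].
- by apply/eqP/val_inj; rewrite /= -ci.
- by have := late z zN sz; rewrite ci leqNgt ltn_ord.
- by have := late y yN sy; rewrite cj leqNgt ltn_ord.
have yz : y = z by apply: sI => //; rewrite (eqP sy) (eqP sz).
have zZ : z \in Z by move: zN; rewrite inE => /andP[].
rewrite yz in yi; have /(congr1 val) := missing_eq _ _ _ zZ yi zj.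
by move=> ij; apply/eqP/val_inj.
Qed.

(** * The detached multigraph and its density *)

Section DetachedMultigraph.

Variables (G : multigraph) (h : edge G -> {set vertex G}).
Hypothesis h_ends : forall e, h e \subset ends e.

(** The pair [(v, e)] names the new end that [e] receives in place of [v]; pairs not arising this
    way are isolated vertices. *)
Definition detached_end (e : edge G) (v : vertex G) :
    (vertex G + vertex G * edge G)%type :=
  if v \in h e then inl v else inr (v, e).

Lemma card_detached_ends e : #|detached_end e @: ends e| = 2.
Proof.
rewrite card_imset ?card_ends // => u v; rewrite /detached_end.
by case: ifP; case: ifP => // _ _ [].
Qed.

Definition detached : multigraph := Multigraph card_detached_ends.

Lemma ends_detached_inl (e : edge G) z :
  (inl z \in @ends detached e) = (z \in h e).
Proof.
apply/imsetP/idP => [[v _] | ze]; first by rewrite /detached_end; case: ifP => // ve [->].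
by exists z; rewrite /detached_end ?ze // (subsetP (h_ends e)).
Qed.

Lemma degree_detached_inl z : @degree detached (inl z) = flag_degree h z.
Proof. by apply: eq_card => e; rewrite !inE ends_detached_inl. Qed.

Lemma degree_detached_inr p : @degree detached (inr p) <= 1.
Proof.
have sub e : inr p \in @ends detached e -> e = p.2.
  by case/imsetP=> v _; rewrite /detached_end; case: ifP => // _ [->].
by apply/card_le1_eqP => e f; rewrite !inE => /sub -> /sub ->.
Qed.

(** An edge within the set has both ends attached in [U], so it contributes 2 to the degree sum; any
    other touching edge contributes at least 1. *)
Lemma edges_within_detached_inl (U : {set vertex G}) :
  #|@edges_within detached (inl @: U)| + touching h U
    <= \sum_(z in U) flag_degree h z.
Proof.
rewrite sum_flag_degree card_setE touchingE -big_split; apply: leq_sum => e _ /=.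
have [sub | _] := boolP (_ \subset _); last first.
  by rewrite -card_gt0; case: #|_|.
suff /subset_leq_card le2 : @ends G e \subset h e :&: U.
  by rewrite card_ends in le2; apply: leq_trans le2; case: (_ != _).
apply/subsetP=> v ve.
have /(subsetP sub)/imsetP[u uU] :=
  imset_f (fun x => detached_end e x) ve.
by rewrite /detached_end inE; case: ifP => // _ [->].
Qed.

Lemma leq_edges_within (H : multigraph) (U : {set vertex H}) :
  2 * #|edges_within U| <= \sum_(x in U) degree x.
Proof.
rewrite (sum_flag_degree (@ends H)) card_setE big_distrr; apply: leq_sum => e _.
by case: (boolP (_ \subset _)) => //= /setIidPl ->; rewrite card_ends.
Qed.

Variables (n : nat) (Z : {set vertex G}).
Hypothesis hZ : forall e, h e \subset Z.
Hypothesis h_exact : forall z, z \in Z -> flag_degree h z = n.+1.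
Hypothesis h_spread : well_spread n Z h.

Lemma flag_degree_notin z : z \notin Z -> flag_degree h z = 0.
Proof.
move=> zZ; apply/eqP; rewrite cards_eq0 -subset0; apply/subsetP=> e.
by rewrite inE => /(subsetP (hZ e)); rewrite (negPf zZ).
Qed.

Lemma degree_detached x : @degree detached x <= n.+1.
Proof.
case: x => [z|p]; last exact: leq_trans (degree_detached_inr p) _.
rewrite degree_detached_inl; have [zZ|zZ] := boolP (z \in Z).
  by rewrite h_exact.
by rewrite flag_degree_notin.
Qed.

Lemma edges_within_detached (U : {set vertex detached}) : odd #|U| ->
  2 * #|edges_within U| <= n.+2 * (#|U| - 1).
Proof.
move=> oU; have [sub | /subsetPn[x xU xZ]] := boolP (U \subset inl @: Z).
  pose W := [set z | inl z \in U].
  have UW : U = inl @: W.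
    apply/setP=> x; apply/idP/imsetP => [xU | [z]]; last by rewrite inE => zU ->.
    by have /imsetP[z _ xz] := subsetP sub x xU; exists z; rewrite ?inE -?xz.
  have cU : #|U| = #|W| by rewrite UW card_imset //; apply: inl_inj.
  have WZ : W \subset Z.
    apply/subsetP=> z; rewrite inE => /(subsetP sub)/imsetP[y yZ [->]] //.
  (* Doubling gives [2 * (n + 1) * #|W| - n * (#|W| + 1) - 2], which is exactly
     [(n + 2) * (#|W| - 1)]. *)
  have := edges_within_detached_inl W; rewrite -UW.
  rewrite (eq_bigr (fun=> n.+1)); last by move=> z /(subsetP WZ)/h_exact.
  rewrite sum_nat_const; rewrite cU in oU *; have := h_spread.2 W WZ oU.
  by case: #|W| oU => // m _; rewrite subn1 /=; lia.
(* A vertex of degree at most 1 in U makes the degree sum small enough. *)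
have dx : degree x <= 1.
  case: x {xU} xZ => [z zZ|p _]; last exact: degree_detached_inr.
  rewrite degree_detached_inl flag_degree_notin //.
  by apply: contra zZ; apply: imset_f.
have := leq_edges_within U; rewrite (big_setD1 x xU) /=.
have : \sum_(y in U :\ x) degree y <= #|U :\ x| * n.+1.
  by rewrite -sum_nat_const; apply: leq_sum => y _; apply: degree_detached.
have := cardsD1 x U; rewrite xU => cU.
rewrite cU add1n subn1 /=; case: #|U :\ x| => [|m]; last by lia.
(* For a singleton, twice the number of edges is at most 1, hence 0. *)
by rewrite mul0n muln0 => sum0; lia.
Qed.

Lemma Gamma_detached : (Gamma detached <= n.+2%:R)%R.
Proof.
apply: bigmax_le => [|U /andP[oU U3]]; first exact: ler0n.
rewrite ler_pdivrMr ?ltr0n ?subn_gt0 ?(ltn_trans _ U3) //.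
by rewrite -natrM ler_nat edges_within_detached.
Qed.

Lemma chromatic_index_detached :
  ((chromatic_index detached)%:Z
     <= Num.max (max_degree detached + 1)%:Z (Num.ceil (Gamma detached)))%R ->
  chromatic_index detached <= n.+2.
Proof.
rewrite -lez_nat => /le_trans; apply; rewrite ge_max; apply/andP; split.
  rewrite lez_nat addn1 ltnS; apply/bigmax_leqP => x _; exact: degree_detached.
by rewrite ceil_le_int; apply: le_trans Gamma_detached _.
Qed.

End DetachedMultigraph.

(** * From the degree and density hypotheses to the covers *)

Theorem theorem3
  (chromatic_index_bound : forall H : multigraph,
     ((chromatic_index H)%:Z
        <= Num.max (max_degree H + 1)%:Z (Num.ceil (Gamma H)))%R)
  (G : multigraph) (Z : {set vertex G}) (k : nat) (k_gt0 : 0 < k)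
  (eps : nat) (eps01 : eps = 0 \/ eps = 1)
  (degZ : forall z : vertex G, z \in Z -> k + 1 <= degree z)
  (oddZ : forall U : {set vertex G}, U \subset Z -> odd #|U| -> 3 <= #|U| ->
     ((#|U| + 1)%:R / 2%:R * k%:R + eps%:R
        <= #|edges_touching U|%:R :> rat)%R) :
  exists C : 'I_(k - 1 + eps) -> {set edge G},
    (forall i, is_cover Z (C i)) /\
    (forall i j, i != j -> [disjoint C i & C j]).
Proof.
set n := k - 1 + eps.
(* All ends outside [Z] are detached at the outset, so [Z] carries every remaining attached end. *)
pose h0 (e : edge G) := ends e :&: Z.
have h02 e : #|h0 e| <= 2 by rewrite -(card_ends e) subset_leq_card ?subsetIl.
have deg0 z : z \in Z -> flag_degree h0 z = degree z.
  by move=> zZ; apply: eq_card => e; rewrite !inE zZ andbT.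
have spread0 : well_spread n Z h0.
  split=> [z zZ | U UZ oU].
    by rewrite deg0 //; have := degZ z zZ; rewrite /n; case: eps01 => ->; lia.
  have touchE : touching h0 U = #|edges_touching U|.
    apply: eq_card => e; rewrite !inE; apply/set0Pn/exists_inP => -[v].
      by rewrite !inE => /andP[/andP[ve _] vU]; exists v.
    by move=> ve vU; exists v; rewrite !inE ve vU (subsetP UZ).
  have [U3 | U1] := leqP 3 #|U|.
    have : (#|U| + 1) * k + 2 * eps <= 2 * #|edges_touching U|.
      rewrite -(ler_nat rat) natrD !natrM; have := oddZ U UZ oU U3.
      lra.
    (* For [eps = 1], [n = k] and the bounds coincide; for [eps = 0], [n = k - 1] and the extra
       [#|U| + 1] covers the 2. *)
    rewrite touchE /n; case: eps01 => ->; nia.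
  (* For a singleton the requirement is degree at least [n + 1], which follows from [degZ] as
     [n <= k]. *)
  have {}U1 : #|U| = 1 by case: #|U| oU U1 => [|[|[]]].
  have /cards1P[z Uz] : #|U| == 1 by rewrite U1.
  have zZ : z \in Z by rewrite (subsetP UZ) // Uz inE.
  have : touching h0 U = degree z.
    rewrite -deg0 // Uz; apply: eq_card => e; rewrite !inE.
    apply/set0Pn/andP => [[y]|[ze _]]; last by exists z; rewrite !inE ze zZ eqxx.
    by rewrite !inE => /andP[/andP[ye yZ] /eqP <-].
  move=> ->; have := degZ z zZ; rewrite U1 /n; case: eps01 => ->; lia.
have [h [hh0 h_spread h_exact]] := exists_exact_detachment h02 spread0.
have h_ends e : h e \subset ends e := subset_trans (hh0 e) (subsetIl _ _).
have hZ e : h e \subset Z := subset_trans (hh0 e) (subsetIr _ _).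
have h2 e : #|h e| <= 2 := leq_trans (subset_leq_card (hh0 e)) (h02 e).
have := chromatic_index_detached h_ends hZ h_exact h_spread
  (chromatic_index_bound _).
rewrite /chromatic_index; case: ex_minnP => q /existsP[c /forallP c_proper] _ qn.
have [|C [C_cover C_disj]] :=
  covers_of_near_coloring (c := fun e => widen_ord qn (c e)) h2 h_exact.
  move=> z e f ze zf /(congr1 val) /= cef.
  have /forallP/(_ (c e))/card_le1_eqP := c_proper (inl z).
  apply; rewrite !inE ends_detached_inl ?ze ?zf ?eqxx //=.
  by apply/eqP/val_inj.
exists C; split=> // i z zZ; have [e eC ze] := C_cover i z zZ.
by exists e => //; apply: (subsetP (h_ends e)).
Qed.
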